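(* Let $X$ be a non-empty subset of $\mathbb{R}^n=\prod_{\nu\in N}\mathbb{R}^{n_\nu}$ and, for each $\nu\in N$, let $\theta_\nu:\mathbb{R}^n\to\mathbb{R}$ be a function. Let $\|\cdot\|$ be a norm on $\mathbb{R}^n$ and define $f_1,f_2:\mathbb{R}^n\times\mathbb{R}^n\to\mathbb{R}$ by $$f_1(x,y):=\|x-y\|,\qquad f_2(x,y):=\sum_{\nu\in N}\theta_\nu(y^\nu,x^{-\nu}).$$ Put $K_1=K_2=X$. If $(\hat x,\hat y)$ is a Nash equilibrium of the two-player game in which player 1 chooses $x\in K_1$ to minimize $f_1(\cdot,y)$ and player 2 chooses $y\in K_2$ to minimize $f_2(x,\cdot)$ (that is, $\hat x,\hat y\in X$, $f_1(\hat x,\hat y)\le f_1(x,\hat y)$ for all $x\in X$, and $f_2(\hat x,\hat y)\le f_2(\hat x,y)$ for all $y\in X$), then $\hat x\in \mathrm{RGNEP}(\{\theta_\nu,X\}_{\nu\in N})$.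
   Context: $N$ is a finite non-empty set of players; player $\nu$ has strategies $x^\nu\in\mathbb{R}^{n_\nu}$, and $\mathbb{R}^n=\prod_{\nu\in N}\mathbb{R}^{n_\nu}$. For $x\in\mathbb{R}^n$, $x^{-\nu}$ denotes the components of $x$ of all players other than $\nu$, and one writes $x=(x^\nu,x^{-\nu})$; thus $(y^\nu,x^{-\nu})$ is $x$ with its $\nu$-component replaced by $y^\nu$. $\mathrm{RGNEP}(\{\theta_\nu,X\}_{\nu\in N})$ is the set of generalized Nash equilibria of Rosen's game: the set of all $\hat x\in X$ such that for every $\nu\in N$ and every $x^\nu\in\mathbb{R}^{n_\nu}$ with $(x^\nu,\hat x^{-\nu})\in X$ one has $\theta_\nu(\hat x)\le\theta_\nu(x^\nu,\hat x^{-\nu})$. *)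

(* Defs.v *)
From HB Require Import structures.
From mathcomp Require Import all_boot all_order all_algebra.
From mathcomp Require Import classical_sets reals.

Set Implicit Arguments.
Unset Strict Implicit.
Unset Printing Implicit Defensive.

Import Order.TTheory GRing.Theory Num.Theory.

Local Open Scope ring_scope.
Local Open Scope classical_set_scope.

(* MathComp equips {ffun I -> V} with a module structure, but not the dependent
   products {dffun forall i, V i}; the pointwise structure is given here. *)
Section DffunZmod.
Context {I : finType} {V : I -> zmodType}.
Local Notation P := {dffun forall i : I, V i}.

Definition dffun_zero : P := [ffun i => 0 : V i].
Definition dffun_add (x y : P) : P := [ffun i => x i + y i : V i].
Definition dffun_opp (x : P) : P := [ffun i => - x i : V i].

Fact dffun_addA : associative dffun_add.
Proof. by move=> x y z; apply/ffunP => i; rewrite !ffunE addrA. Qed.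

Fact dffun_addC : commutative dffun_add.
Proof. by move=> x y; apply/ffunP => i; rewrite !ffunE addrC. Qed.

Fact dffun_add0 : left_id dffun_zero dffun_add.
Proof. by move=> x; apply/ffunP => i; rewrite !ffunE add0r. Qed.

Fact dffun_addN : left_inverse dffun_zero dffun_opp dffun_add.
Proof. by move=> x; apply/ffunP => i; rewrite !ffunE addNr. Qed.

HB.instance Definition _ := GRing.isZmodule.Build P
  dffun_addA dffun_addC dffun_add0 dffun_addN.

End DffunZmod.

Section DffunLmod.
Context {R : pzRingType} {I : finType} {V : I -> lmodType R}.
Local Notation P := {dffun forall i : I, V i}.

Definition dffun_scale (a : R) (x : P) : P := [ffun i => a *: x i : V i].

Fact dffun_scaleA a b (x : P) :
  dffun_scale a (dffun_scale b x) = dffun_scale (a * b) x.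
Proof. by apply/ffunP => i; rewrite !ffunE scalerA. Qed.

Fact dffun_scale1 : left_id 1 dffun_scale.
Proof. by move=> x; apply/ffunP => i; rewrite !ffunE scale1r. Qed.

Fact dffun_scaleDr : right_distributive dffun_scale +%R.
Proof. by move=> a x y; apply/ffunP => i; rewrite !ffunE scalerDr. Qed.

Fact dffun_scaleDl (x : P) : {morph dffun_scale^~ x : a b / a + b}.
Proof. by move=> a b; apply/ffunP => i; rewrite !ffunE scalerDl. Qed.

HB.instance Definition _ := GRing.Zmodule_isLmodule.Build R P
  dffun_scaleA dffun_scale1 dffun_scaleDr dffun_scaleDl.

End DffunLmod.

Definition profile (R : realType) (N : finType) (n : N -> nat) :=
  {dffun forall nu : N, 'rV[R]_(n nu)}.
HB.instance Definition _ (R : realType) (N : finType) (n : N -> nat) :=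
  GRing.Lmodule.on (profile R n).

(* (y, x^{-nu}) *)
Definition deviate (R : realType) (N : finType) (n : N -> nat)
    (nu : N) (y : 'rV[R]_(n nu)) (x : profile R n) : profile R n :=
  finfun (dfwith x y).

(* These are the axioms of the factory Lmodule_isNormed of MathComp-Analysis,
   as a predicate, so that the norm can be an arbitrary function. *)
Record is_norm (R : numFieldType) (V : lmodType R) (norm : V -> R) : Prop := {
  is_norm_triangle : forall x y : V, norm (x + y) <= norm x + norm y ;
  is_norm_scale : forall (a : R) (x : V), norm (a *: x) = `|a| * norm x ;
  is_norm_definite : forall x : V, norm x = 0 -> x = 0
}.

Definition nash2 (R : realType) (S1 S2 : Type) (K1 : set S1) (K2 : set S2)
    (f1 f2 : S1 -> S2 -> R) : set (S1 * S2) :=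
  [set z | [/\ K1 z.1, K2 z.2,
               forall x, K1 x -> f1 z.1 z.2 <= f1 x z.2
             & forall y, K2 y -> f2 z.1 z.2 <= f2 z.1 y]].

Definition RGNEP (R : realType) (N : finType) (n : N -> nat)
    (theta : N -> profile R n -> R) (X : set (profile R n)) :
    set (profile R n) :=
  [set x | X x /\
     forall (nu : N) (y : 'rV[R]_(n nu)),
       X (deviate y x) -> theta nu x <= theta nu (deviate y x)].

(* Main.v *)
Require Import Defs.
From mathcomp Require Import all_boot all_order all_algebra.
From mathcomp Require Import classical_sets reals.

Import Order.TTheory GRing.Theory Num.Theory.

Local Open Scope ring_scope.
Local Open Scope classical_set_scope.

(** Player 1 may answer [yh] by [yh] itself, which costs [norm 0 = 0]; since a
    norm is nonnegative and definite, optimality of [xh] forces [xh = yh].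
    Player 2's optimality then says that [xh] minimizes
    [\sum_nu theta nu (deviate (y nu) xh)] over [y] in [X].  Test it against a
    feasible unilateral deviation [y := deviate v xh] of a single player [nu]:
    each other player still plays their component of [xh], so their summand is
    the same on both sides, and cancelling these leaves exactly the equilibrium
    inequality of player [nu]. *)

Section Norm.
Context {R : numFieldType} {V : lmodType R} {norm : V -> R}.
Context (norm_axioms : is_norm norm).

Lemma is_norm0 : norm 0 = 0.
Proof. by rewrite -(scale0r 0) (is_norm_scale norm_axioms) normr0 mul0r. Qed.

(** The triangle inequality for [x] and [- x] gives [0 <= 2 * norm x]. *)
Lemma is_norm_ge0 x : 0 <= norm x.
Proof.
have := is_norm_triangle norm_axioms x (- x).
rewrite subrr is_norm0 -scaleN1r (is_norm_scale norm_axioms) normrN1 mul1r.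
by rewrite -mulr2n pmulrn_lge0.
Qed.

Lemma is_norm_le0_eq x y : norm (x - y) <= 0 -> x = y.
Proof.
move=> le0; apply/eqP; rewrite -subr_eq0; apply/eqP.
apply: (is_norm_definite norm_axioms); apply/eqP.
by rewrite eq_le le0 is_norm_ge0.
Qed.

End Norm.

Section Deviate.
Context {R : realType} {N : finType} {n : N -> nat}.
Implicit Types x : profile R n.

Lemma deviate_same nu (y : 'rV[R]_(n nu)) x : deviate y x nu = y.
Proof. by rewrite ffunE dfwith_in. Qed.

Lemma deviate_other nu mu (y : 'rV[R]_(n nu)) x :
  nu != mu -> deviate y x mu = x mu.
Proof. by move=> neq; rewrite ffunE dfwith_out. Qed.

Lemma deviate_id nu x : deviate (x nu) x = x.
Proof.
by apply/ffunP => mu; rewrite ffunE; case: dfwithP => // i _.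
Qed.

(** The objective of player 2 sees a deviation of one player only through the
    summand of that player. *)
Lemma sum_deviate_deviate (theta : N -> profile R n -> R) nu
    (v : 'rV[R]_(n nu)) x :
  \sum_(mu : N) theta mu (deviate (deviate v x mu) x)
  = theta nu (deviate v x) + \sum_(mu | mu != nu) theta mu x.
Proof.
rewrite (bigD1 nu) //= deviate_same; congr (_ + _).
apply: eq_bigr => mu neq.
by rewrite deviate_other ?deviate_id // eq_sym.
Qed.

End Deviate.

Theorem proposition3p7 (R : realType) (N : finType) (n : N -> nat)
  (N_neq0 : (0 < #|N|)%N)
  (X : set (profile R n)) (X_neq0 : X !=set0)
  (theta : N -> profile R n -> R)
  (norm : profile R n -> R) (norm_axioms : is_norm norm)
  (xh yh : profile R n) :
  let f1 (x y : profile R n) := norm (x - y) in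
  let f2 (x y : profile R n) := \sum_(nu : N) theta nu (deviate (y nu) x) in
  nash2 X X f1 f2 (xh, yh) ->
  RGNEP theta X xh.
Proof.
move=> f1 f2 [/= Xx Xy min1 min2].
have eq_xy : xh = yh.
  apply: (is_norm_le0_eq norm_axioms).
  by have := min1 yh Xy; rewrite /f1 subrr (is_norm0 norm_axioms).
subst yh; split=> // nu v Xv.
have := min2 _ Xv; rewrite /f2 sum_deviate_deviate (bigD1 nu) //= deviate_id.
under eq_bigr => mu _ do rewrite deviate_id.
by rewrite lerD2r.
Qed.
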